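(* Let $\mathcal{D} = \{(\mathbf{x}_i, y_i)\}_{i=1}^N$ with $\mathbf{x}_i \in \mathbb{R}^d$, $y_i \in \mathbb{R}$, let $\mathcal{D}^{\hat f} = \{(\mathbf{x}'_i, \hat f(\mathbf{x}'_i))\}_{i=1}^L$ with $\mathbf{x}'_i \in \mathbb{R}^d$, let $C \in [0,1]$, and let $k$ be a covariance function on $\mathbb{R}^d$ such that $K = \{k(\mathbf{x}_i,\mathbf{x}_j)\}_{i,j=1}^N$ is invertible. Let $s$ be the Gaussian process regression surrogate with covariance function $k$ conditioned on $\mathcal{D}$. Then the computational complexity of evaluating the loss function $$L(s, \hat f, \mathcal{D}, \mathcal{D}^{\hat f}) = -(1-C)\, \log p(\mathbf{y}\mid X, s) + C \sum_{i=1}^{L} \bigl(s(\mathbf{x}'_i) - \hat f(\mathbf{x}'_i)\bigr)^2$$ is $O(N^3) + O(LN)$; that is, there is a procedure which computes this value using $O(N^3) + O(LN)$ elementary operations.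
   Context: Setting: $\hat f : \mathbb{R}^d \to \mathbb{R}$ is a fixed deterministic ''base'' model available as a black box. $\mathcal{D}$ is the training sample, with $X = (\mathbf{x}_1,\dots,\mathbf{x}_N)$ and $\mathbf{y} = (y_1,\dots,y_N)^T$. $\mathcal{D}^{\hat f}$ is an additional sample of inputs together with the base model's values at them. (The letter $L$ denotes both the loss function and the size of the additional sample.) Gaussian process surrogate: $k$ is a symmetric positive definite covariance function, $K = \{k(\mathbf{x}_i,\mathbf{x}_j)\}_{i,j=1}^N$ is the $N\times N$ covariance matrix on the training inputs, and $\boldsymbol{\alpha} = K^{-1}\mathbf{y}$. The prediction of the surrogate at a point $\mathbf{x}$ is the conditional mean $$s(\mathbf{x}) = \mathbf{k}(\mathbf{x})^T K^{-1}\mathbf{y} = \mathbf{k}(\mathbf{x})^T \boldsymbol{\alpha}, \qquad \mathbf{k}(\mathbf{x}) = \bigl(k(\mathbf{x},\mathbf{x}_1),\dots,k(\mathbf{x},\mathbf{x}_N)\bigr)^T.$$ The data log-likelihood is the Gaussian log marginal likelihood $$\log p(\mathbf{y}\mid X, s) = -\tfrac12\bigl(N\log(2\pi) + \log\det K + \mathbf{y}^T K^{-1}\mathbf{y}\bigr).$$ Cost model: real arithmetic operations ($+,-,\times,\div$), a logarithm, and an evaluation of $k$ at a pair of points each count as one elementary operation; the values $\hat f(\mathbf{x}'_i)$ are given as part of the input. The $O(\cdot)$ constants do not depend on $N$, $L$, the data, $C$, or $k$. *)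

(* Defs.v *)
From HB Require Import structures.
From mathcomp Require Import all_boot all_order all_algebra.
From mathcomp Require Import all_classical all_reals all_analysis.

Set Implicit Arguments.
Unset Strict Implicit.
Unset Printing Implicit Defensive.

Import Order.TTheory GRing.Theory Num.Theory.
Local Open Scope ring_scope.

(* A covariance function is only required to be positive semidefinite on finite
   families of (possibly repeated) points; nondegeneracy of the Gram matrix is
   a separate hypothesis. *)
Definition covariance_function (R : realType) (d : nat)
    (k : 'rV[R]_d -> 'rV[R]_d -> R) : Prop :=
  (forall u v, k u v = k v u) /\
  (forall (n : nat) (z : 'I_n -> 'rV[R]_d) (c : 'I_n -> R),
     0 <= \sum_(i < n) \sum_(j < n) c i * c j * k (z i) (z j)).

Definition gram (R : realType) (d N : nat) (k : 'rV[R]_d -> 'rV[R]_d -> R)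
    (x : 'I_N -> 'rV[R]_d) : 'M[R]_N :=
  \matrix_(i, j) k (x i) (x j).

Definition cov_vec (R : realType) (d N : nat) (k : 'rV[R]_d -> 'rV[R]_d -> R)
    (x : 'I_N -> 'rV[R]_d) (u : 'rV[R]_d) : 'cV[R]_N :=
  \col_i k u (x i).

Definition surrogate (R : realType) (d N : nat)
    (k : 'rV[R]_d -> 'rV[R]_d -> R) (x : 'I_N -> 'rV[R]_d) (y : 'cV[R]_N)
    (u : 'rV[R]_d) : R :=
  ((cov_vec k x u)^T *m invmx (gram k x) *m y) 0 0.

Definition log_likelihood (R : realType) (d N : nat)
    (k : 'rV[R]_d -> 'rV[R]_d -> R) (x : 'I_N -> 'rV[R]_d) (y : 'cV[R]_N) : R :=
  - (2%:R^-1 * (N%:R * ln (2%:R * pi) + ln (\det (gram k x))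
                + (y^T *m invmx (gram k x) *m y) 0 0)).

Definition loss (R : realType) (d N L : nat) (C : R)
    (k : 'rV[R]_d -> 'rV[R]_d -> R) (x : 'I_N -> 'rV[R]_d) (y : 'cV[R]_N)
    (fhat : 'rV[R]_d -> R) (x' : 'I_L -> 'rV[R]_d) : R :=
  - (1 - C) * log_likelihood k x y
  + C * \sum_(i < L) (surrogate k x y (x' i) - fhat (x' i)) ^+ 2.

(* The computational model is a real random-access machine presented as a small
   imperative language: one finite program text serves all sizes N and L, with
   control by bounded loops over natural-number indices. Points of R^d are
   opaque to a program, which can only pass them to the covariance oracle. *)

Inductive index_expr : Type :=
| INum of nat
| IVar of nat
| ITrainSize
| IAddSize
| IAdd of index_expr & index_expr
| ISub of index_expr & index_expr
| IMul of index_expr & index_expr.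

Inductive point_expr : Type :=
| PTrain of index_expr
| PAdd of index_expr.

(* [RRead a i j] is the entry (i, j) of the working array number [a]. *)
Inductive real_expr (R : Type) : Type :=
| RConst of R
| RRead of nat & index_expr & index_expr
| RTarget of index_expr
| RBase of index_expr
| RWeight
| RCov of point_expr & point_expr
| RPlus of real_expr R & real_expr R
| RMinus of real_expr R & real_expr R
| RTimes of real_expr R & real_expr R
| RDivide of real_expr R & real_expr R
| RLog of real_expr R.
Arguments RRead {R}.
Arguments RTarget {R}.
Arguments RBase {R}.
Arguments RWeight {R}.
Arguments RCov {R}.

(* [CFor v e c] runs [c] for v = 0, ..., e - 1. *)
Inductive command (R : Type) : Type :=
| CSkip
| CSeq of command R & command R
| CStore of nat & index_expr & index_expr & real_expr R
| CFor of nat & index_expr & command R.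
Arguments CSkip {R}.

Record procedure (R : Type) : Type := Procedure {
  proc_body : command R;
  proc_result : real_expr R }.

Record gp_input (R : realType) (d : nat) : Type := GPInput {
  train_size : nat;
  add_size : nat;
  train_point : 'I_train_size -> 'rV[R]_d;
  train_value : 'cV[R]_train_size;
  add_point : 'I_add_size -> 'rV[R]_d;
  base_value : 'I_add_size -> R;
  weight : R;
  cov : 'rV[R]_d -> 'rV[R]_d -> R }.

Fixpoint ieval (R : realType) (d : nat) (inp : gp_input R d) (env : nat -> nat)
    (e : index_expr) : nat :=
  match e with
  | INum n => n
  | IVar v => env v
  | ITrainSize => train_size inp
  | IAddSize => add_size inp
  | IAdd a b => (ieval inp env a + ieval inp env b)%N
  | ISub a b => (ieval inp env a - ieval inp env b)%N
  | IMul a b => (ieval inp env a * ieval inp env b)%N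
  end.

(* Reading an input out of range is undefined ([None]). *)
Definition peval (R : realType) (d : nat) (inp : gp_input R d)
    (env : nat -> nat) (p : point_expr) : option 'rV[R]_d :=
  match p with
  | PTrain e => omap (train_point (g := inp)) (insub (ieval inp env e))
  | PAdd e => omap (add_point (g := inp)) (insub (ieval inp env e))
  end.

Definition memory (R : Type) : Type := nat -> nat -> nat -> R.

Definition obind2 (A B D : Type) (f : A -> B -> option D)
    (a : option A) (b : option B) : option D :=
  obind (fun u => obind (f u) b) a.

(* Division by zero and the logarithm of a nonpositive number are undefined, so
   that a program cannot use the library's default values to branch on reals. *)
Fixpoint reval (R : realType) (d : nat) (inp : gp_input R d) (env : nat -> nat)
    (m : memory R) (e : real_expr R) : option R :=
  match e with
  | RConst c => Some c
  | RRead a i j => Some (m a (ieval inp env i) (ieval inp env j))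
  | RTarget i =>
      omap (fun n => train_value inp n 0) (insub (ieval inp env i))
  | RBase i => omap (base_value (g := inp)) (insub (ieval inp env i))
  | RWeight => Some (weight inp)
  | RCov p q =>
      obind2 (fun u v => Some (cov inp u v)) (peval inp env p) (peval inp env q)
  | RPlus a b =>
      obind2 (fun u v => Some (u + v)) (reval inp env m a) (reval inp env m b)
  | RMinus a b =>
      obind2 (fun u v => Some (u - v)) (reval inp env m a) (reval inp env m b)
  | RTimes a b =>
      obind2 (fun u v => Some (u * v)) (reval inp env m a) (reval inp env m b)
  | RDivide a b =>
      obind2 (fun u v => if v == 0 then None else Some (u / v))
             (reval inp env m a) (reval inp env m b)
  | RLog a =>
      obind (fun u => if 0 < u then Some (ln u) else None) (reval inp env m a)
  end.

(* Arithmetic operations, logarithms and covariance evaluations have unit cost;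
   constants, reads, stores and index bookkeeping are not charged. *)
Fixpoint rcost (R : Type) (e : real_expr R) : nat :=
  match e with
  | RConst _ | RRead _ _ _ | RTarget _ | RBase _ | RWeight => 0
  | RCov _ _ => 1
  | RPlus a b | RMinus a b | RTimes a b | RDivide a b => (rcost a + rcost b).+1
  | RLog a => (rcost a).+1
  end.

Definition store (R : Type) (m : memory R) (a i j : nat) (r : R) : memory R :=
  fun a' i' j' => if [&& a' == a, i' == i & j' == j] then r else m a' i' j'.

Definition set_index (env : nat -> nat) (v n : nat) : nat -> nat :=
  fun w => if w == v then n else env w.

(* The machine state is the memory together with the number of elementary
   operations performed so far. *)
Fixpoint exec (R : realType) (d : nat) (inp : gp_input R d) (env : nat -> nat)
    (c : command R) (st : memory R * nat) : option (memory R * nat) :=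
  match c with
  | CSkip => Some st
  | CSeq c1 c2 => obind (exec inp env c2) (exec inp env c1 st)
  | CStore a i j e =>
      omap (fun r => (store st.1 a (ieval inp env i) (ieval inp env j) r,
                      (st.2 + rcost e)%N))
           (reval inp env st.1 e)
  | CFor v e c1 =>
      iteri (ieval inp env e)
            (fun n => obind (exec inp (set_index env v n) c1)) (Some st)
  end.

(* Returns the computed value and the number of elementary operations used. *)
Definition run (R : realType) (d : nat) (P : procedure R) (inp : gp_input R d) :
    option (R * nat) :=
  let env0 := fun _ => 0%N in
  obind (fun st => omap (fun r => (r, (st.2 + rcost (proc_result P))%N))
                        (reval inp env0 st.1 (proc_result P)))
        (exec inp env0 (proc_body P) ((fun _ _ _ => 0), 0%N)).

(* Main.v *)
Require Import Defs.
From HB Require Import structures.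
From mathcomp Require Import all_boot all_order all_algebra.
From mathcomp Require Import all_classical all_reals all_analysis.
From mathcomp Require Import zify ring lra.

Set Implicit Arguments.
Unset Strict Implicit.
Unset Printing Implicit Defensive.

Import Order.TTheory GRing.Theory Num.Theory.
Local Open Scope ring_scope.


(** Gaussian elimination without pivoting on the 2N x (N+1) matrix
    [[K, y], [-I, 0]] takes O(N^3) operations. It leaves alpha = K^-1 y in the
    lower half of the last column, and the product of its pivots is det K; a
    positive semidefinite invertible K is positive definite, so the pivots are
    positive and neither a division nor the final logarithm is undefined.
    Each of the L values s(x'_l) is then a scalar product of length N. *)

(** * Gaussian elimination: determinant, positivity of the pivots, linear system *)

Section Elimination.
Variable R : realType.
Implicit Types (A : nat -> nat -> R) (N p : nat).

(** The pivot row is updated like every other row, so for a nonzero pivot it becomes zero. A step is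
    thus the subtraction of one rank-one matrix, with the same formula at all [i] and [j]. *)
Definition elim_step A p : nat -> nat -> R :=
  fun i j => A i j - A i p * A p j / A p p.

Fixpoint elim A p : nat -> nat -> R :=
  if p is q.+1 then elim_step (elim A q) q else A.

(** Step [j] clears column [j]; a later step subtracts multiples of a row whose entry in that column
    is already zero. [elim_row0] is the transposed argument. *)
Lemma elim_col0 A p i j :
  (forall q, (q < p)%N -> elim A q q q != 0) -> (j < p)%N -> elim A p i j = 0.
Proof.
elim: p i j => // p IH i j piv; rewrite ltnS leq_eqVlt /= /elim_step.
have IH' i' j' : (j' < p)%N -> elim A p i' j' = 0.
  by apply: IH => q qp; apply: piv; rewrite ltnS ltnW.
case/orP => [/eqP ->|jp]; last by rewrite (IH' i j jp) (IH' p j jp) mulr0 mul0r subr0.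
by rewrite mulfK ?subrr // piv.
Qed.

Lemma elim_row0 A p i j :
  (forall q, (q < p)%N -> elim A q q q != 0) -> (i < p)%N -> elim A p i j = 0.
Proof.
elim: p i j => // p IH i j piv; rewrite ltnS leq_eqVlt /= /elim_step.
have IH' i' j' : (i' < p)%N -> elim A p i' j' = 0.
  by apply: IH => q qp; apply: piv; rewrite ltnS ltnW.
case/orP => [/eqP ->|ip]; last by rewrite (IH' i j ip) (IH' i p ip) !mul0r subr0.
by rewrite mulrAC mulfV ?mul1r ?subrr // piv.
Qed.

(** Each step subtracts from a row a multiple of the current pivot row. By induction the product of
    that pivot row with [w] is still its initial value, which is zero. *)
Lemma elim_mulr A p n (w : nat -> R) i :
  (forall q, (q < p)%N -> \sum_(j < n) A q j * w j = 0) ->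
  \sum_(j < n) elim A p i j * w j = \sum_(j < n) A i j * w j.
Proof.
elim: p i => // p IH i Aw /=.
have IH' i' : \sum_(j < n) elim A p i' j * w j = \sum_(j < n) A i' j * w j.
  by apply: IH => q qp; apply: Aw; rewrite ltnS ltnW.
rewrite -(IH' i) /elim_step.
under eq_bigr => j _ do rewrite mulrBl.
rewrite sumrB; apply/eqP; rewrite subr_eq addrC -subr_eq subrr eq_sym; apply/eqP.
transitivity (elim A p i p / elim A p p p * \sum_(j < n) elim A p p j * w j).
  by rewrite mulr_sumr; apply: eq_bigr => j _; ring.
by rewrite IH' Aw // mulr0.
Qed.

(* The differences of consecutive stages are the rank-one terms of an LU
   factorization, and the last stage vanishes. *)
Lemma det_elim A N :
  (forall q, (q < N)%N -> elim A q q q != 0) ->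
  \det (\matrix_(i < N, j < N) A i j) = \prod_(q < N) elim A q q q.
Proof.
move=> piv.
pose Lo := \matrix_(i < N, q < N) (elim A q i q / elim A q q q).
pose Up := \matrix_(q < N, j < N) elim A q q j.
have -> : \matrix_(i < N, j < N) A i j = Lo *m Up.
  apply/matrixP => i j; rewrite !mxE.
  have tel n : A i j = elim A n i j +
      \sum_(q < n) elim A q i q / elim A q q q * elim A q q j.
    elim: n => [|n IH]; first by rewrite big_ord0 addr0.
    by rewrite big_ord_recr /= /elim_step {1}IH; ring.
  rewrite (tel N) elim_col0 // add0r.
  by apply: eq_bigr => q _; rewrite !mxE.
have piv' (q : 'I_N) r : (r < q)%N -> elim A r r r != 0.
  by move=> rq; apply: piv; apply: ltn_trans rq _.
rewrite det_mulmx [X in X * _]det_trig; last first.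
  apply/is_trig_mxP => i q iq; rewrite mxE elim_row0 ?mul0r //.
  exact: piv'.
rewrite -[X in _ * X]det_tr [X in _ * X]det_trig; last first.
  apply/is_trig_mxP => i q iq; rewrite !mxE elim_col0 //; exact: piv'.
(* The diagonal of [Lo] consists of ones, that of [Up] of the pivots. *)
rewrite big1 ?mul1r => [|q _]; first by apply: eq_bigr => q _; rewrite !mxE.
by rewrite mxE mulfV // piv.
Qed.

Definition quad_form N A (c : nat -> R) : R :=
  \sum_(i < N) c i * \sum_(j < N) A i j * c j.

(** Completing the square: with e_p the unit vector, A (c - t e_p) equals the eliminated matrix
    applied to c. The choice of [t] makes its entry [p] zero, so changing the left factor from c to
    c - t e_p does not alter the form. *)
Lemma quad_form_elim_step N A p (c : nat -> R) : (p < N)%N -> A p p != 0 ->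
  let t := (\sum_(j < N) A p j * c j) / A p p in
  quad_form N (elim_step A p) c =
  quad_form N A (fun i => c i - t * (i == p)%:R).
Proof.
move=> pN piv t.
have delta (F : nat -> R) : \sum_(i < N) F i * (i == p :> nat)%:R = F p.
  rewrite (bigD1 (Ordinal pN)) //= eqxx mulr1 big1 ?addr0 // => i.
  by rewrite -val_eqE /= => /negbTE ->; rewrite mulr0.
pose r i := \sum_(j < N) A i j * c j.
have row i : \sum_(j < N) A i j * (c j - t * (j == p :> nat)%:R) = r i - t * A i p.
  under eq_bigr => j _ do rewrite mulrBr mulrCA.
  by rewrite sumrB -mulr_sumr delta.
have row' i : \sum_(j < N) elim_step A p i j * c j = r i - t * A i p.
  under eq_bigr => j _ do rewrite mulrBl.
  rewrite sumrB; congr (_ - _).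
  transitivity (A i p / A p p * \sum_(j < N) A p j * c j); last by rewrite /t; ring.
  by rewrite mulr_sumr; apply: eq_bigr => j _; ring.
rewrite /quad_form.
under [RHS]eq_bigr => i _ do rewrite row mulrBl.
under [LHS]eq_bigr => i _ do rewrite row'.
rewrite sumrB.
have -> : \sum_(i < N) t * (i == p :> nat)%:R * (r i - t * A i p) = 0.
  transitivity (\sum_(i < N) t * (r i - t * A i p) * (i == p :> nat)%:R).
    by apply: eq_bigr => i _; ring.
  by rewrite (delta (fun i => t * (r i - t * A i p))) /t divfK // subrr mulr0.
by rewrite subr0.
Qed.

(** Induction on the stage: stage [q] has zero rows and columns below [q], so the invariant [H]
    claims strict positivity only for vectors with a nonzero coordinate at some index from [q] on.
    The pivot is the value of the form at a unit vector. *)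
Lemma elim_pivot_gt0 N A p :
  (forall c : nat -> R, (exists2 i, (i < N)%N & c i != 0) -> 0 < quad_form N A c) ->
  (p < N)%N -> 0 < elim A p p p.
Proof.
move=> pd.
suff H q : (q <= N)%N ->
    (forall c : nat -> R, (exists2 i, (q <= i < N)%N & c i != 0) ->
     0 < quad_form N (elim A q) c) /\ ((q < N)%N -> 0 < elim A q q q).
  by move=> pN; apply: (H p (ltnW pN)).2.
have piv_gt0 r : (forall c : nat -> R, (exists2 i, (r <= i < N)%N & c i != 0) ->
     0 < quad_form N (elim A r) c) -> (r < N)%N -> 0 < elim A r r r.
  move=> H rN; have := H (fun i => (i == r)%:R).
  have -> : quad_form N (elim A r) (fun i => (i == r)%:R) = elim A r r r.
    rewrite /quad_form (bigD1 (Ordinal rN)) //= eqxx mul1r [X in _ + X]big1 ?addr0.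
      rewrite (bigD1 (Ordinal rN)) //= eqxx mulr1 big1 ?addr0 // => i.
      by rewrite -val_eqE /= => /negbTE ->; rewrite mulr0.
    by move=> i; rewrite -val_eqE /= => /negbTE ->; rewrite mul0r.
  by apply; exists r; rewrite ?leqnn ?eqxx ?oner_eq0.
elim: q => [|q IH] qN.
  have pd0 c : (exists2 i, (0 <= i < N)%N & c i != 0) -> 0 < quad_form N (elim A 0) c.
    by case=> i /andP[_ iN] ci; apply: pd; exists i.
  by split=> //; apply: piv_gt0.
have [IHq /(_ qN) piv] := IH (ltnW qN).
have pdq c : (exists2 i, (q.+1 <= i < N)%N & c i != 0) ->
    0 < quad_form N (elim A q.+1) c.
  case=> i /andP[qi iN] ci; rewrite /= quad_form_elim_step ?gt_eqF //.
  (* The shift of the completed square only touches coordinate [q], so the nonzero coordinate [i] >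
     [q] survives. *)
  apply: IHq; exists i; first by rewrite ltnW.
  by rewrite gtn_eqF // mulr0 subr0.
by split=> //; apply: piv_gt0.
Qed.

(** If the form vanished at [c], then along c + t v with v = M c it would be 2 t |v|^2 + t^2 q.
    Nonnegativity for a small negative t forces v = 0, and invertibility then gives c = 0. *)
Lemma psd_unit_gt0 n (M : 'M[R]_n) (c : 'cV[R]_n) :
  M^T = M -> (forall v : 'cV[R]_n, 0 <= (v^T *m M *m v) 0 0) ->
  M \in unitmx -> c != 0 -> 0 < (c^T *m M *m c) 0 0.
Proof.
move=> Msym psd Mu c0; rewrite lt_neqAle psd andbT eq_sym.
apply: contra c0 => /eqP cMc0.
pose v := M *m c.
suff v0 : v = 0.
  by rewrite -[c](mulKmx Mu) -/v v0 mulmx0.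
pose a : R := (v^T *m v) 0 0; pose q : R := (v^T *m M *m v) 0 0.
have aE : a = \sum_i v i 0 ^+ 2.
  by rewrite /a mxE; apply: eq_bigr => i _; rewrite mxE expr2.
have q0 : 0 <= q by apply: psd.
have q1 : q + 1 != 0 by rewrite gt_eqF // ltr_wpDl.
have exp t : ((c + t *: v)^T *m M *m (c + t *: v)) 0 0 = 2 * t * a + t ^+ 2 * q.
  have cMv : c^T *m M *m v = v^T *m v by rewrite /v trmx_mul Msym.
  have -> : (c + t *: v)^T = c^T + t *: v^T by rewrite linearD /= linearZ.
  rewrite !mulmxDl !mulmxDr -!scalemxAl -!scalemxAr cMv -[v^T *m M *m c]mulmxA -/v.
  have entry (B D E F : 'M[R]_1) :
      (B + D + (E + F)) 0 0 = B 0 0 + D 0 0 + (E 0 0 + F 0 0) by rewrite !mxE.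
  have entryZ s (B : 'M[R]_1) : (s *: B) 0 0 = s * B 0 0 by rewrite mxE.
  by rewrite entry !entryZ cMc0 -/a -/q; ring.
have a0 : a = 0.
  (* The denominator is [q + 1] because [q] itself may be zero. *)
  have := psd (c + (- (a / (q + 1))) *: v); rewrite exp.
  have -> : 2 * - (a / (q + 1)) * a + (- (a / (q + 1))) ^+ 2 * q
          = - ((q + 2) * (a / (q + 1)) ^+ 2).
    by field.
  rewrite oppr_ge0 => le0.
  have q2 : 0 < q + 2 by rewrite ltr_wpDl.
  move: le0; rewrite pmulr_rle0 // => le0.
  have /eqP : (a / (q + 1)) ^+ 2 = 0 by apply/le_anti; rewrite le0 sqr_ge0.
  by rewrite sqrf_eq0 mulf_eq0 invr_eq0 (negbTE q1) orbF => /eqP.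
apply/colP => i; rewrite !mxE.
have /eqP := a0; rewrite aE psumr_eq0 => [/allP /(_ i)|j _]; last exact: sqr_ge0.
by rewrite mem_index_enum sqrf_eq0 => /(_ isT) /eqP; rewrite mxE.
Qed.

(* Eliminating the first block column of [[K, y], [-I, 0]] leaves K^-1 y in the
   lower right corner: [(-K^-1 y, 1)] is mapped to [(0, K^-1 y)] at every stage. *)
Lemma elim_solve N A (K : 'M[R]_N) (y : 'cV[R]_N) :
  K \in unitmx ->
  (forall i j : 'I_N, A i j = K i j) -> (forall i : 'I_N, A i N = y i 0) ->
  (forall i j : 'I_N, A (N + i)%N j = - (i == j)%:R) ->
  (forall i : 'I_N, A (N + i)%N N = 0) ->
  (forall q, (q < N)%N -> elim A q q q != 0) ->
  forall i : 'I_N, elim A N (N + i)%N N = (invmx K *m y) i 0.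
Proof.
move=> Ku AK Ay AI A0 piv i; set al := invmx K *m y.
(* The default branch supplies the last coordinate 1, at index [N]. *)
pose w n := if insub n is Some j then - al j 0 else 1.
have wl (j : 'I_N) : w j = - al j 0 by rewrite /w valK.
have wN : w N = 1 by rewrite /w insubF // ltnn.
have top q : (q < N)%N -> \sum_(j < N.+1) A q j * w j = 0.
  move=> qN; rewrite big_ord_recr /= wN mulr1 (Ay (Ordinal qN)).
  have -> : y = K *m al by rewrite mulKVmx.
  rewrite mxE; apply/eqP; rewrite addr_eq0 -sumrN; apply/eqP.
  by apply: eq_bigr => j _; rewrite (AK (Ordinal qN)) wl mulrN.
have := elim_mulr (N + i)%N top.
(* At stage [N] the first [N] columns are zero, so only the entry in column [N] remains of the
   eliminated row's product with [w]. *)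
rewrite !big_ord_recr /= wN !mulr1 A0 addr0 big1 ?add0r => [->|j _].
  rewrite (bigD1 i) //= AI wl eqxx mulrNN mul1r big1 ?addr0 // => j ji.
  by rewrite AI eq_sym (negbTE ji) oppr0 mul0r.
by rewrite elim_col0 ?mul0r.
Qed.

End Elimination.

(** * Hoare-style rules for total correctness with operation counts *)

Section ProgramLogic.
Variables (R : realType) (d : nat) (inp : gp_input R d).
Implicit Types (env : nat -> nat) (m : memory R) (Q : memory R -> Prop).

(** Execution must be defined and add at most [b] operations. Quantifying over the initial counter
    [t] makes the bounds additive under sequencing. *)
Definition wp env (c : command R) m Q (b : nat) : Prop :=
  forall t, exists m' t',
    [/\ exec inp env c (m, t) = Some (m', t'), Q m' & (t' <= t + b)%N].

Lemma wp_mono env c m Q Q' b b' :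
  (forall m', Q m' -> Q' m') -> (b <= b')%N -> wp env c m Q b -> wp env c m Q' b'.
Proof.
move=> QQ' bb' H t; have [m' [t' [e q le]]] := H t.
by exists m', t'; split; [|exact: QQ'|lia].
Qed.

Lemma wp_seq env c1 c2 m Q Q' b1 b2 :
  wp env c1 m Q b1 -> (forall m', Q m' -> wp env c2 m' Q' b2) ->
  wp env (CSeq c1 c2) m Q' (b1 + b2).
Proof.
move=> H1 H2 t; have [m1 [t1 [e1 /H2 q1 le1]]] := H1 t.
have [m2 [t2 [e2 q2 le2]]] := q1 t1.
by exists m2, t2; split=> //=; [rewrite e1 /= e2|lia].
Qed.

Lemma wp_store env a i j e m r Q :
  reval inp env m e = Some r ->
  Q (store m a (ieval inp env i) (ieval inp env j) r) ->
  wp env (CStore a i j e) m Q (rcost e).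
Proof.
move=> er q t; exists (store m a (ieval inp env i) (ieval inp env j) r).
by exists (t + rcost e)%N; split=> //=; rewrite er.
Qed.

Lemma wp_for env v e c m (I : nat -> memory R -> Prop) b :
  I 0%N m ->
  (forall n m', (n < ieval inp env e)%N -> I n m' ->
     wp (set_index env v n) c m' (I n.+1) b) ->
  wp env (CFor v e c) m (I (ieval inp env e)) (ieval inp env e * b).
Proof.
move=> I0 step t; rewrite /=.
move: (ieval inp env e) step => n step.
elim: n step => [|n IH] step; first by exists m, t; split=> //; rewrite addn0.
have [|m' [t' [e1 q le]]] := IH; first by move=> i m' ni; apply: step; apply: ltnW.
have [m2 [t2 [e2 q2 le2]]] := step n m' (leqnn _) q t'.
by exists m2, t2; split=> //=; [rewrite e1 /= e2|lia].
Qed.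

Definition fill T en eq (e : real_expr R) : command R :=
  CFor 1 en (CFor 2 eq (CStore T (IVar 1) (IVar 2) e)).

(** The expression is evaluated while [T] is partly overwritten, so its value is required in every
    memory that agrees with [m] outside [T]. *)
Lemma wp_fill env (T : nat) en eq e m (f : nat -> nat -> R) :
  (forall w, ieval inp (set_index env 1 w) eq = ieval inp env eq) ->
  (forall i j m', (i < ieval inp env en)%N -> (j < ieval inp env eq)%N ->
     (forall a, a != T -> m' a = m a) ->
     reval inp (set_index (set_index env 1 i) 2 j) m' e = Some (f i j)) ->
  wp env (fill T en eq e) m
    (fun m' => (forall a, a != T -> m' a = m a) /\
       forall i j, m' T i j =
         if (i < ieval inp env en)%N && (j < ieval inp env eq)%N then f i j
         else m T i j)
    (ieval inp env en * (ieval inp env eq * rcost e)).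
Proof.
move=> eqw ef.
(* Row-major progress: the rows before [i] are complete, and row [i] is filled up to column [j]. *)
pose I i j m' := (forall a, a != T -> m' a = m a) /\ forall i' j', m' T i' j' =
  if [|| (i' < i)%N && (j' < ieval inp env eq)%N | (i' == i) && (j' < j)%N] then f i' j'
  else m T i' j'.
apply: (@wp_mono _ _ _ (I (ieval inp env en) 0%N) _ _ _ _ (leqnn _)).
  move=> m' [frame val]; split=> // i j.
  by rewrite val ltn0 andbF orbF.
apply: (wp_for (I := fun i => I i 0%N)).
  by split=> // i j; rewrite !ltn0 andbF.
move=> i m' ilt Im'; rewrite -(eqw i).
apply: (@wp_mono _ _ _ (I i (ieval inp (set_index env 1 i) eq)) _ _ _ _ (leqnn _)).
  move=> m2 [frame val]; split=> // i' j'; rewrite val eqw ltnS [(i' <= i)%N]leq_eqVlt ltn0.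
  by case: (eqVneq i' i) => [->|_]; rewrite ?ltnn !andbF !orbF.
apply: wp_for => // j m2; rewrite eqw => jlt [frame val].
apply: wp_store; first exact: ef.
split=> [a aT|i' j'] /=.
  by apply/funext => i'; apply/funext => j'; rewrite /store (negbTE aT) frame.
rewrite /store eqxx /= /set_index /= val ltnS [(j' <= j)%N]leq_eqVlt.
case: (eqVneq i' i) => [->|_] /=; last by rewrite !orbF.
by rewrite ltnn /=; case: (eqVneq j' j) => [->|_].
Qed.

Definition sum_into T v en (e : real_expr R) : command R :=
  CSeq (CStore T (INum 0) (INum 0) (RConst 0))
    (CFor v en (CStore T (INum 0) (INum 0) (RPlus (RRead T (INum 0) (INum 0)) e))).

Lemma wp_sum_into env (T : nat) v en e m (f : nat -> R) :
  (forall i m', (i < ieval inp env en)%N -> (forall a, a != T -> m' a = m a) ->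
     reval inp (set_index env v i) m' e = Some (f i)) ->
  wp env (sum_into T v en e) m
    (fun m' => (forall a, a != T -> m' a = m a) /\
       m' T 0%N 0%N = \sum_(i < ieval inp env en) f i)
    (ieval inp env en * (rcost e).+1).
Proof.
move=> ef.
have frame_store m' i j r : (forall a, a != T -> m' a = m a) ->
    forall a, a != T -> store m' T i j r a = m a.
  move=> frame a aT; apply/funext => i'; apply/funext => j'.
  by rewrite /store (negbTE aT) frame.
pose I i m' := (forall a, a != T -> m' a = m a) /\ m' T 0%N 0%N = \sum_(j < i) f j.
rewrite -[(_ * _)%N]add0n; apply: (@wp_seq _ _ _ _ (I 0%N)).
  apply: (wp_store (e := RConst 0)); first by [].
  by split; [exact: frame_store|rewrite /store /= eqxx big_ord0].
move=> m1 I1; apply: (wp_for (I := I)) => // i m2 ilt [frame val].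
apply: (wp_store (e := RPlus _ _)); first by rewrite /= ef //.
split; first exact: frame_store.
by rewrite /store /= eqxx big_ord_recr /= val.
Qed.

End ProgramLogic.

(** * The program text *)

Section Procedure.
Variable R : realType.

(* Array 0 holds the matrix under elimination; the accumulators are the cells
   (0, 0) of the arrays 2 (det K), 3 (y^T alpha), 4 (N log(2 pi)), 5 (s(x'_l))
   and 6 (sum of squares). *)
Definition cell (a : nat) : real_expr R := RRead a (INum 0) (INum 0).

(** Only K, y and the diagonal of -I are written; the other zeros of the lower half are those of the
    initial memory. *)
Definition load : command R :=
  CSeq (fill 0 ITrainSize ITrainSize (RCov (PTrain (IVar 1)) (PTrain (IVar 2))))
    (CFor 0 ITrainSize
      (CSeq (CStore 0 (IVar 0) ITrainSize (RTarget (IVar 0)))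
        (CStore 0 (IAdd ITrainSize (IVar 0)) (IVar 0) (RConst (-1))))).

Definition fill_augmented (T : nat) (e : real_expr R) : command R :=
  fill T (IAdd ITrainSize ITrainSize) (IAdd ITrainSize (INum 1)) e.

(* Array 1 is a snapshot of array 0, because the update of array 0 overwrites
   the pivot row and column. *)
Definition eliminate : command R :=
  CSeq (CStore 2 (INum 0) (INum 0) (RConst 1))
    (CFor 0 ITrainSize
      (CSeq (fill_augmented 1 (RRead 0 (IVar 1) (IVar 2)))
        (CSeq (fill_augmented 0
            (RMinus (RRead 1 (IVar 1) (IVar 2))
              (RDivide (RTimes (RRead 1 (IVar 1) (IVar 0)) (RRead 1 (IVar 0) (IVar 2)))
                (RRead 1 (IVar 0) (IVar 0)))))
          (CStore 2 (INum 0) (INum 0)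
            (RTimes (cell 2) (RRead 1 (IVar 0) (IVar 0))))))).

Definition coefficient (v : nat) : real_expr R :=
  RRead 0 (IAdd ITrainSize (IVar v)) ITrainSize.

Definition squared_misfit : command R :=
  CSeq (CStore 6 (INum 0) (INum 0) (RConst 0))
    (CFor 0 IAddSize
      (CSeq (sum_into 5 1 ITrainSize
              (RTimes (RCov (PAdd (IVar 0)) (PTrain (IVar 1))) (coefficient 1)))
        (CStore 6 (INum 0) (INum 0)
          (RPlus (cell 6) (RTimes (RMinus (cell 5) (RBase (IVar 0)))
                                  (RMinus (cell 5) (RBase (IVar 0)))))))).

(** Indices cannot be converted to reals, so N log(2 pi) is accumulated by adding the constant log(2
    pi) [N] times. The factor -(1 - C) appears as C - 1. *)
Definition loss_procedure : procedure R :=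
  Procedure
    (CSeq load (CSeq eliminate
      (CSeq (sum_into 3 0 ITrainSize (RTimes (RTarget (IVar 0)) (coefficient 0)))
        (CSeq (sum_into 4 0 ITrainSize (RConst (ln (2%:R * pi))))
          squared_misfit))))
    (RPlus
      (RTimes (RMinus (RWeight) (RConst 1))
        (RMinus (RConst 0) (RTimes (RConst 2%:R^-1)
          (RPlus (RPlus (cell 4) (RLog (cell 2))) (cell 3)))))
      (RTimes RWeight (cell 6))).

Definition extend_ord (T : Type) (x0 : T) n (f : 'I_n -> T) (i : nat) : T :=
  oapp f x0 (insub i).

Lemma extend_ordE (T : Type) (x0 : T) n (f : 'I_n -> T) (i : 'I_n) :
  extend_ord x0 f i = f i.
Proof. by rewrite /extend_ord valK. Qed.

Lemma omap_insub (T : Type) (x0 : T) n (f : 'I_n -> T) i : (i < n)%N ->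
  omap f (insub i) = Some (extend_ord x0 f i).
Proof. by move=> iltn; rewrite /extend_ord insubT. Qed.

(** * Correctness and cost of each phase on a fixed input *)

Variables (d : nat) (inp : gp_input R d).
Let N := train_size inp.
Let L := add_size inp.
Let xt := extend_ord 0 (train_point (g := inp)).
Let xa := extend_ord 0 (add_point (g := inp)).
Let yt := extend_ord 0 (fun i => train_value inp i 0).
Let fb := extend_ord 0 (base_value (g := inp)).

Definition is_augmented (A : nat -> nat -> R) : Prop :=
  [/\ forall i j, (i < N)%N -> (j < N)%N -> A i j = cov inp (xt i) (xt j),
      forall i, (i < N)%N -> A i N = yt i,
      forall i j, (i < N)%N -> (j < N)%N -> A (N + i)%N j = - (i == j)%:R
    & forall i, (i < N)%N -> A (N + i)%N N = 0].

Lemma wp_load env :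
  wp inp env load (fun _ _ _ => 0) (fun m => is_augmented (m 0%N)) (N * N).
Proof.
(* After [n] rounds, y and the diagonal of -I are present in their first [n] rows. *)
pose I n (m : memory R) :=
  [/\ forall i j, (i < N)%N -> (j < N)%N -> m 0%N i j = cov inp (xt i) (xt j),
      forall i, (i < n)%N -> m 0%N i N = yt i,
      forall i j, (i < N)%N -> (j < N)%N ->
        m 0%N (N + i)%N j = - ((i < n)%N && (i == j))%:R
    & forall i, (i < N)%N -> m 0%N (N + i)%N N = 0].
apply: (@wp_mono _ _ _ _ _ _ (I N) _ (N * (N * 1) + N * (0 + 0))); last 1 first.
- apply: wp_seq.
    apply: (wp_fill (f := fun i j => cov inp (xt i) (xt j))) => // i j m' iN jN _ /=.
    by rewrite /set_index /= !(omap_insub 0).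
  move=> m' [_ val]; apply: (wp_for (I := I)); rewrite -/N /=.
    split=> [i j iN jN|//|i j iN jN|i iN]; rewrite val /= -/N ?iN ?jN //.
      by rewrite ltnNge leq_addr oppr0.
    by rewrite ltnn andbF.
  move=> n m1 nN [mK my mI m0]; apply: (wp_seq (b1 := 0) (b2 := 0)).
    apply: (wp_store (e := RTarget _)); first exact: (omap_insub 0).
    (* The intermediate assertion is instantiated here to equality with the memory after the first
       store. *)
    exact: erefl.
  move=> m2 <-; apply: (wp_store (e := RConst _)); first by [].
  rewrite /= /set_index /= -/N; split.
  + move=> i j iN jN; rewrite /store /=.
    have -> : (i == N + n)%N = false by lia.
    have -> : (j == N)%N = false by lia.
    by rewrite andbF mK.
  + move=> i; rewrite ltnS => ile; rewrite /store /=.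
    have -> : (i == N + n)%N = false by lia.
    by rewrite eqxx andbT /=; case: eqVneq => [-> //|ni]; apply: my; lia.
  + move=> i j iN jN; rewrite /store /= eqn_add2l.
    have -> : (j == N)%N = false by lia.
    rewrite andbF mI // ltnS [(i <= n)%N]leq_eqVlt.
    case: (eqVneq i n) => [->|_] //=.
    by rewrite ltnn /= eq_sym; case: eqP.
  + move=> i iN; rewrite /store /=.
    have -> : (N == n)%N = false by lia.
    have -> : (N + i == n)%N = false by lia.
    by rewrite andbF /= m0.
- by move=> m [mK my mI m0]; split=> // i j iN jN; rewrite mI ?iN.
- by rewrite muln1 muln0 addn0.
Qed.

(** A stage costs three operations at each of the 2N(N+1) entries and one for the pivot product; the
    snapshot is made of reads and stores, which are free. Nonzero pivots keep the divisions
    defined. *)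
Lemma wp_eliminate env (m : memory R) :
  (forall q, (q < N)%N -> elim (m 0%N) q q q != 0) ->
  wp inp env eliminate m
    (fun m' => (forall i j, (i < N + N)%N -> (j < N + 1)%N ->
                  m' 0%N i j = elim (m 0%N) N i j) /\
               m' 2%N 0%N 0%N = \prod_(q < N) elim (m 0%N) q q q)
    (N * ((N + N) * ((N + 1) * 3) + 1)).
Proof.
move=> piv.
pose I n (m' : memory R) :=
  (forall i j, (i < N + N)%N -> (j < N + 1)%N -> m' 0%N i j = elim (m 0%N) n i j) /\
  m' 2%N 0%N 0%N = \prod_(q < n) elim (m 0%N) q q q.
rewrite -[X in wp _ _ _ _ _ X]add0n; apply: (@wp_seq _ _ _ _ _ _ _ (I 0%N)).
  apply: (wp_store (e := RConst _)); first by [].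
  by split=> //; rewrite big_ord0.
move=> m0 I0; apply: (wp_for (I := I)) => // n m1 nN [val prd].
rewrite -[(_ + 1)%N]add0n; apply: wp_seq.
  apply: (@wp_mono _ _ _ _ _ _ _ _ _ _ (fun _ h => h)); last first.
    apply: (wp_fill (f := m1 0%N)) => // i j m' iN jN frame /=.
    by rewrite /set_index /= frame.
  by rewrite /= !muln0.
move=> m2 [frame2 val2].
have snap i j : (i < N + N)%N -> (j < N + 1)%N -> m2 1%N i j = elim (m 0%N) n i j.
  by move=> iN jN; rewrite val2 /= -/N iN jN /= val.
have nNN : (n < N + N)%N by rewrite /= -/N in nN; lia.
have nN1 : (n < N + 1)%N by rewrite /= -/N in nN; lia.
apply: wp_seq.
  apply: (wp_fill (f := elim (m 0%N) n.+1)) => // i j m' /=.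
  rewrite -/N => iN jN frame; rewrite /set_index /= frame // !snap //.
  by rewrite /= (negbTE (piv _ nN)).
(* The pivot comes from the snapshot, since entry [(n, n)] of array 0 is zero by now. *)
move=> m3 [frame3 val3]; apply: (wp_store (e := RTimes _ _)); first by [].
split=> [i j iN jN|]; first by rewrite /store /= val3 /= -/N iN jN.
by rewrite /store /= !frame3 // frame2 // prd snap // big_ord_recr.
Qed.

(** Per additional point, each training point costs a covariance evaluation, a product and an
    addition; the squared residual takes two subtractions, a product and an addition. *)
Lemma wp_squared_misfit env (m : memory R) (al : nat -> R) :
  (forall i, (i < N)%N -> m 0%N (N + i)%N N = al i) ->
  wp inp env squared_misfit m
    (fun m' => [/\ m' 2%N = m 2%N, m' 3%N = m 3%N, m' 4%N = m 4%N &
       m' 6%N 0%N 0%N = \sum_(l < L)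
         (\sum_(i < N) cov inp (xa l) (xt i) * al i - fb l) ^+ 2])
    (L * (N * 3 + 4)).
Proof.
move=> mal.
pose I n (m' : memory R) :=
  (forall a, (a < 5)%N -> m' a = m a) /\ m' 6%N 0%N 0%N = \sum_(l < n)
    (\sum_(i < N) cov inp (xa l) (xt i) * al i - fb l) ^+ 2.
apply: (@wp_mono _ _ _ _ _ _ (I L) _ (0 + L * (N * 3 + 4)) _ _ (leqnn _)).
  by move=> m' [frame ->]; rewrite !frame.
apply: (@wp_seq _ _ _ _ _ _ _ (I 0%N)).
  apply: (wp_store (e := RConst _)); first by [].
  split=> [a a5|]; last by rewrite big_ord0.
  apply/funext => i; apply/funext => j; rewrite /store.
  by have -> : (a == 6)%N = false by lia.
move=> m0 I0; apply: (wp_for (I := I)) => // n m1 nL [frame val].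
apply: wp_seq.
  apply: (wp_sum_into (f := fun i => cov inp (xa n) (xt i) * al i)) => i m' /= iN frame'.
  rewrite /set_index /= !(omap_insub 0) //= frame' //.
  by rewrite frame // mal.
move=> m2 [frame2 val2]; apply: (wp_store (e := RPlus _ _)).
  by rewrite /= /set_index /= (omap_insub 0).
split=> [a a5|].
  apply/funext => i; apply/funext => j; rewrite /store.
  have -> /= : (a == 6)%N = false by lia.
  by rewrite frame2 ?frame //; lia.
by rewrite /store /= big_ord_recr /= frame2 // val val2 expr2.
Qed.

End Procedure.

(** * Positive definiteness of the Gram matrix, and the final bound *)

Lemma gram_quad_form_gt0 (R : realType) (d N : nat) (x : 'I_N -> 'rV[R]_d)
    (k : 'rV[R]_d -> 'rV[R]_d -> R) (A : nat -> nat -> R) (c : nat -> R) :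
  covariance_function k -> gram k x \in unitmx ->
  (forall i j : 'I_N, A i j = k (x i) (x j)) ->
  (exists2 i, (i < N)%N & c i != 0) -> 0 < quad_form N A c.
Proof.
move=> [ksym kpsd] Ku AE [i iN ci].
have quadE (v : 'cV[R]_N) : (v^T *m gram k x *m v) 0 0 =
    \sum_(i < N) \sum_(j < N) v i 0 * v j 0 * k (x i) (x j).
  rewrite -mulmxA mxE; apply: eq_bigr => i' _; rewrite !mxE mulr_sumr.
  by apply: eq_bigr => j _; rewrite !mxE; ring.
have -> : quad_form N A c = ((\col_i c i)^T *m gram k x *m \col_i c i) 0 0.
  rewrite quadE; apply: eq_bigr => i' _; rewrite mulr_sumr.
  by apply: eq_bigr => j _; rewrite !mxE AE; ring.
apply: psd_unit_gt0 => // [|v|].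
- by apply/matrixP => i' j; rewrite !mxE.
- by rewrite quadE.
- apply: contra ci => /eqP /colP /(_ (Ordinal iN)).
  by rewrite !mxE => ->.
Qed.

Theorem mainTheorem1 (R : realType) (d : nat) :
  exists (P : procedure R) (c1 c2 : nat),
  forall (N L : nat) (x : 'I_N -> 'rV[R]_d) (y : 'cV[R]_N)
         (fhat : 'rV[R]_d -> R) (x' : 'I_L -> 'rV[R]_d) (C : R)
         (k : 'rV[R]_d -> 'rV[R]_d -> R),
    (0 < N)%N ->
    0 <= C <= 1 ->
    covariance_function k ->
    gram k x \in unitmx ->
    exists n : nat,
      run P (GPInput x y x' (fun i => fhat (x' i)) C k)
        = Some (loss C k x y fhat x', n) /\
      (n <= c1 * N ^ 3 + c2 * (L * N))%N.

Proof.
(* The phases and the 9 operations of the result expression add up to at most 6N^3 + 7N^2 + 4N + 9 +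
   3LN + 4L. As N is at least 1, this is below 26N^3 + 7LN or equal to it, so both constants are
   generous. *)
exists (loss_procedure R), 40%N, 10%N.
move=> N L x y fhat x' C k N0 _ kcov Ku.
set inp := GPInput _ _ _ _ _ _.
pose al (i : nat) := extend_ord 0 (fun i : 'I_N => (invmx (gram k x) *m y) i 0) i.
(* Positivity of the determinant cell is recorded because [RLog] is undefined otherwise. *)
pose Q (m : memory R) :=
  [/\ m 2%N 0%N 0%N = \det (gram k x), 0 < m 2%N 0%N 0%N,
      m 3%N 0%N 0%N = (y^T *m invmx (gram k x) *m y) 0 0,
      m 4%N 0%N 0%N = N%:R * ln (2%:R * pi)
    & m 6%N 0%N 0%N = \sum_(i < L) (surrogate k x y (x' i) - fhat (x' i)) ^+ 2].
have H : wp inp (fun=> 0%N) (proc_body (loss_procedure R)) (fun _ _ _ => 0) Q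
    (N * N + (N * ((N + N) * ((N + 1) * 3) + 1) + (N * 2 + (N * 1 + L * (N * 3 + 4))))).
  apply: wp_seq; first exact: wp_load.
  move=> m1 [mK my mI mO].
  have AE (i j : 'I_N) : m1 0%N i j = k (x i) (x j) by rewrite mK //= !extend_ordE.
  have piv q : (q < N)%N -> 0 < elim (m1 0%N) q q q.
    apply: elim_pivot_gt0 => c; exact: gram_quad_form_gt0 AE.
  have piv0 q : (q < N)%N -> elim (m1 0%N) q q q != 0 by move/piv; apply: lt0r_neq0.
  have alE i : (i < N)%N -> elim (m1 0%N) N (N + i)%N N = al i.
    move=> iN; rewrite -[i]/(nat_of_ord (Ordinal iN)) /al extend_ordE.
    apply: elim_solve => // [i' j|i'|i' j|i'].
    - by rewrite AE mxE.
    - by rewrite my //= extend_ordE.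
    - exact: mI.
    - exact: mO.
  apply: wp_seq; first exact: wp_eliminate.
  move=> m2 [m2A m2D].
  have m2al i : (i < N)%N -> m2 0%N (N + i)%N N = al i.
    by move=> iN; rewrite m2A -?alE //=; lia.
  apply: wp_seq.
    apply: (wp_sum_into (f := fun i =>
      extend_ord 0 (fun i : 'I_N => y i 0) i * al i)) => i m' /= iN frame.
    by rewrite /set_index /= (omap_insub 0) //= frame // m2al.
  move=> m3 [m3f m3v]; apply: wp_seq.
    by apply: (wp_sum_into (f := fun=> ln (2%:R * pi))).
  move=> m4 [m4f m4v].
  have m4al i : (i < N)%N -> m4 0%N (N + i)%N N = al i.
    by move=> iN; rewrite m4f // m3f // m2al.
  have := @wp_squared_misfit R d inp (fun=> 0%N) m4 al m4al.
  apply: wp_mono (leqnn _).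
  move=> m5 [e2 e3 e4 e6].
  have det2 : m5 2%N 0%N 0%N = \prod_(q < N) elim (m1 0%N) q q q.
    by rewrite e2 m4f // m3f // m2D.
  have gramE : gram k x = \matrix_(i < N, j < N) m1 0%N i j.
    by apply/matrixP => i j; rewrite !mxE AE.
  split.
  - by rewrite det2 gramE det_elim.
  - by rewrite det2; apply: prodr_gt0 => q _; apply: piv.
  - rewrite e3 m4f // m3v -mulmxA mxE; apply: eq_bigr => i _.
    by rewrite /al !extend_ordE [y^T _ _]mxE.
  - by rewrite e4 m4v /= sumr_const card_ord [RHS]mulr_natl.
  - rewrite e6; apply: eq_bigr => l _; rewrite /= !extend_ordE; congr ((_ - _) ^+ 2).
    rewrite /surrogate -mulmxA mxE; apply: eq_bigr => i _.
    by rewrite /al !extend_ordE !mxE.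
have [m [t [em [q2 pos q3 q4 q6] le]]] := H 0%N.
exists (t + rcost (proc_result (loss_procedure R)))%N; split.
  rewrite /run em /= pos /=; congr (Some (_, _)).
  by rewrite q2 q3 q4 q6 /loss /log_likelihood; ring.
move: le; rewrite /= => le; nia.
Qed.
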